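(* Let $f(X)=a_{0}+a_{1}X+\cdots +a_{n}X^{n}\in \mathbb{Z}[X]$, $a_{0}a_{n}\neq 0$. Suppose there exist two distinct prime numbers $p$ and $q$ such that (i) $\nu _{p}(a_{1})=0$, $\nu _{p}(a_{n})>0$, and $\frac{\nu _{p}(a_{i})}{i-1}>\frac{\nu _{p}(a_{n})}{n-1}$ for $1<i<n$; (ii) $\nu _{q}(a_{0})=0$, $\frac{\nu _{q}(a_{i})}{i}\geq\frac{\nu _{q}(a_{n})}{n}$ for all $1\le i\le n$, and $n\nmid \nu _{q}(a_{n})$; (iii) $\gcd(\nu _{p}(a_{n}),n-1)=1$. Then $f$ is irreducible over $\mathbb{Q}$.
   Context: For a prime $p$ and a nonzero integer $m$, $\nu_p(m)$ is the largest integer $i$ such that $p^i\mid m$; by convention $\nu_p(0)=\infty$ (so lower bounds on $\nu_p(a_i)$ hold automatically when $a_i=0$). *)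

(* Defs.v *)
From mathcomp Require Import all_boot all_order all_algebra.
From mathcomp Require Import constructive_ereal.

Set Implicit Arguments.
Unset Strict Implicit.
Unset Printing Implicit Defensive.

Import Order.TTheory GRing.Theory Num.Theory.

Local Open Scope ring_scope.

(* The finite value of the p-adic valuation. Meaningful for [m != 0] only, since
   [logn p 0 = 0]. *)
Definition nu_fin (p : nat) (m : int) : nat := logn p `|m|%N.

Definition nu (p : nat) (m : int) : \bar rat :=
  if m == 0 then +oo%E else (nu_fin p m)%:R%:E.

(* Main.v *)
(* By the p-adic Newton polygon, whose edge from 1 to n has slope
   nu_p(a_n) / (n - 1) in lowest terms, in any factorisation f = g h over the
   integers one factor has degree at least n - 1. By the q-adic polygon, whose
   single edge has the non-integral slope nu_q(a_n) / n, no factor is linear. *)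
Require Import Defs.
From mathcomp Require Import all_boot all_order all_algebra.
From mathcomp Require Import constructive_ereal zify.

Set Implicit Arguments.
Unset Strict Implicit.
Unset Printing Implicit Defensive.

Import Order.TTheory GRing.Theory Num.Theory.

Local Open Scope ring_scope.

(** * Supporting lines of Newton polygons *)

(** For [D > 0] the level sets are the lines of slope [-E / D] through the points [(i, nu_p(g_i))].
    Keeping the slope as an integer pair makes weights integers. The value means something only
    where the coefficient is nonzero. *)
Definition weight (p : nat) (D E : int) (g : {poly int}) (i : nat) : int :=
  D * (nu_fin p g`_i)%:Z + E * i%:Z.

(** For [D > 0], a vertex that a supporting line touches alone; zero coefficients are points at
    infinity and are skipped. *)
Definition unique_minimizer p D E (g : {poly int}) a :=
  g`_a != 0 /\
  forall i, g`_i != 0 -> i != a -> weight p D E g a < weight p D E g i.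

Lemma dvdz_nu_fin p m k : prime p -> m != 0 ->
  (((p ^ k)%N : int) %| m)%Z = (k <= nu_fin p m)%N.
Proof. by move=> pp m0; rewrite dvdzE /= pfactor_dvdn // absz_gt0. Qed.

Lemma nu_finM p x y : x != 0 -> y != 0 ->
  nu_fin p (x * y) = (nu_fin p x + nu_fin p y)%N.
Proof. by move=> x0 y0; rewrite /nu_fin abszM lognM ?absz_gt0. Qed.

Lemma unique_minimizer_inj p D E g a b :
  unique_minimizer p D E g a -> unique_minimizer p D E g b -> a = b.
Proof.
move=> [ga Ha] [gb Hb]; apply/eqP; apply: contraT => ab.
have := Ha _ gb; have := Hb _ ga ab; rewrite eq_sym ab => H1 /(_ isT) H2.
by have := lt_trans H1 H2; rewrite ltxx.
Qed.

(** Weights of terms add up, so among all [g_i h_j] only the pair [(a, b)] has least weight. It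
    cannot be cancelled in coefficient [a + b], and every other coefficient is a sum of heavier
    terms. *)
Lemma unique_minimizerM p D E g h a b : prime p -> 0 < D ->
    unique_minimizer p D E g a -> unique_minimizer p D E h b ->
  unique_minimizer p D E (g * h) (a + b).
Proof.
move=> pp D0 [ga Ha] [hb Hb].
set V := (nu_fin p g`_a + nu_fin p h`_b)%N.
have term i j : g`_i * h`_j != 0 -> (i, j) != (a, b) ->
    D * V%:Z + E * (a + b)%N%:Z
      < D * (nu_fin p (g`_i * h`_j))%:Z + E * (i + j)%N%:Z.
  rewrite mulf_eq0 negb_or => /andP[gi hj]; rewrite xpair_eqE negb_and nu_finM //.
  rewrite /V !PoszD !mulrDr.
  have Hi : weight p D E g a <= weight p D E g i.
    by have [->//|ia] := eqVneq i a; apply/ltW/Ha.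
  have Hj : weight p D E h b <= weight p D E h j.
    by have [->//|jb] := eqVneq j b; apply/ltW/Hb.
  move: Hi Hj; rewrite /weight => Hi Hj.
  case/orP => [/(Ha _ gi)|/(Hb _ hj)]; rewrite /weight; lia.
(* Stated as a divisibility, the strict bound covers zero terms and passes to sums. *)
have dvd_term i j k : (i, j) != (a, b) ->
    D * k%:Z + E * (i + j)%N%:Z <= D * V%:Z + E * (a + b)%N%:Z ->
    (((p ^ k.+1)%N : int) %| g`_i * h`_j)%Z.
  move=> ij Hk; have [->|nz] := eqVneq (g`_i * h`_j) 0; first exact: dvdz0.
  rewrite dvdz_nu_fin //; have := le_lt_trans Hk (term _ _ nz ij).
  by rewrite ltrD2r ltr_pM2l.
have [r gh_ab dr] : exists2 r, (g * h)`_(a + b) = g`_a * h`_b + r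
    & (((p ^ V.+1)%N : int) %| r)%Z.
  have lt_a : (a < (a + b).+1)%N by rewrite ltnS leq_addr.
  rewrite coefM (bigD1 (Ordinal lt_a)) //= addKn; eexists; first by [].
  apply: rpred_sum => i ia; apply: dvd_term; last by rewrite subnKC // -ltnS.
  by rewrite xpair_eqE negb_and (_ : (i : nat) != a).
have gahb : g`_a * h`_b != 0 by rewrite mulf_neq0.
have vgahb : nu_fin p (g`_a * h`_b) = V by rewrite nu_finM.
have ghab0 : (g * h)`_(a + b) != 0.
  apply/eqP => gh0; have : (((p ^ V.+1)%N : int) %| g`_a * h`_b)%Z.
    by rewrite -(rpredDr _ dr) -gh_ab gh0 dvdz0.
  by rewrite dvdz_nu_fin // vgahb ltnn.
have vgh : nu_fin p (g * h)`_(a + b) = V.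
  apply/eqP; rewrite eqn_leq; apply/andP; split.
    rewrite leqNgt -dvdz_nu_fin // gh_ab rpredDr //.
    by rewrite dvdz_nu_fin // vgahb ltnn.
  rewrite -dvdz_nu_fin // gh_ab rpredD //; first by rewrite dvdz_nu_fin ?vgahb.
  by apply: (dvdz_trans _ dr); rewrite dvdzE /= dvdn_exp2l.
(* If [l] were no heavier, all its terms, hence their sum, would be divisible by one more power of
   [p] than the coefficient allows. *)
split=> // l ghl lab; rewrite /weight vgh ltNge; apply/negP => le_l.
have : (((p ^ (nu_fin p (g * h)`_l).+1)%N : int) %| (g * h)`_l)%Z.
  rewrite [X in (_ %| X)%Z]coefM; apply: rpred_sum => i _; apply: dvd_term.
    by apply: contraNneq lab => -[<- <-]; rewrite subnKC // -ltnS.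
  by rewrite subnKC // -ltnS.
by rewrite dvdz_nu_fin // ltnn.
Qed.

(* Modulo [N] a weight only depends on the index, and determines it. *)
Lemma unique_minimizer_exists p D E N (g : {poly int}) : g != 0 ->
    (size g <= N)%N -> (N %| `|D|)%N -> coprime N `|E| ->
  exists2 a, unique_minimizer p D E g a & (a < size g)%N.
Proof.
move=> g0 gN ND NE.
have sz : ((size g).-1 < size g)%N by rewrite prednK // size_poly_gt0.
have lead0 : g`_(Ordinal sz) != 0 by rewrite /= -lead_coefE lead_coef_eq0.
have [i gi mini] := arg_minP (fun i : 'I__ => weight p D E g i)
  (lead0 : [pred i : 'I__ | g`_i != 0] _).
exists i => //; split=> // j gj ji.
have jg : (j < size g)%N by rewrite ltnNge; apply: contra gj => /(nth_default 0) ->.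
rewrite lt_neqAle (mini (Ordinal jg)) // andbT.
apply: contra ji; rewrite /weight => /eqP Wij.
(* Equal weights force [N] to divide [j - i], whose absolute value is below [N]. *)
have : (N%:Z %| E * (j%:Z - i%:Z))%Z.
  have -> : E * (j%:Z - i%:Z) = D * ((nu_fin p g`_i)%:Z - (nu_fin p g`_j)%:Z).
    rewrite !mulrBr; lia.
  by apply: dvdz_mulr; rewrite dvdzE.
rewrite Gauss_dvdzr // dvdzE /= => dij.
have ilt := ltn_ord i.
have [dij0|pos] := posnP `|(j%:Z - i%:Z)|%N.
  by move/eqP: dij0; rewrite absz_eq0 subr_eq0 eqz_nat.
have := dvdn_leq pos dij; lia.
Qed.

(** * Edges of the Newton polygon of a product *)

(* The points [a] and [b] span an edge of the Newton polygon of [g * h], which is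
   the sum of the parallel edges (possibly points) of [g] and [h], of horizontal
   lengths [k] and [l]. Perturbing the slope by [1 / N] in either direction
   singles out the left and right ends of all three edges. *)
Lemma newton_edge_mul p (d e : int) a b (g h : {poly int}) : prime p -> 0 < d ->
    (a <= b)%N -> (g * h)`_a != 0 -> (g * h)`_b != 0 ->
    weight p d e (g * h) b = weight p d e (g * h) a ->
    (forall i, (g * h)`_i != 0 ->
      weight p d e (g * h) a < weight p d e (g * h) i ?<= if (a <= i <= b)%N) ->
  exists k l : nat, [/\ (k + l)%N = (b - a)%N, (k < size g)%N, (l < size h)%N,
    (d %| e * k)%Z & (d %| e * l)%Z].
Proof.
move=> pp d0 ab gha ghb Wb Wi.
have gh0 : g * h != 0 by apply: contraNneq gha => ->; rewrite coef0.
have [g0 h0] : g != 0 /\ h != 0.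
  by move: gh0; rewrite mulf_eq0 negb_or => /andP.
(* [N] exceeds every index in play, so after scaling by [N] a gap between integer weights outweighs
   any difference of indices. *)
set N := (size (g * h)%R + size g + size h)%N.
have N0 : (0 < N)%N by rewrite /N -addnA ltn_addr // lt0n size_poly_eq0.
have lt_gh i : (g * h)`_i != 0 -> (i < N)%N.
  move=> ghi; rewrite /N -addnA ltn_addr // ltnNge.
  by apply: contra ghi => /(nth_default 0) ->.
have weightN s (f : {poly int}) i :
    weight p (d * N%:Z) (e * N%:Z + s) f i = N%:Z * weight p d e f i + s * i%:Z.
  by rewrite /weight mulrDl mulrDr addrA; congr (_ + _ + _); rewrite mulrCA mulrA.
have ex s (f : {poly int}) : `|s|%N = 1%N -> f != 0 -> (size f <= N)%N ->
    exists2 c, unique_minimizer p (d * N%:Z) (e * N%:Z + s) f c & (c < size f)%N.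
  move=> s1 f0 fN; apply: (@unique_minimizer_exists _ _ _ N) => //.
    by rewrite abszM dvdn_mull.
  have : coprimez N%:Z (e * N%:Z + s).
    by rewrite /coprimez gcdzMDl /gcdz s1 gcdn1.
  by rewrite coprimezE.
have gN : (size g <= N)%N by rewrite /N; lia.
have hN : (size h <= N)%N by rewrite /N; lia.
have DN : 0 < d * N%:Z by rewrite mulr_gt0.
(* The perturbation [1] breaks ties towards the smallest index, [-1] towards the largest. *)
have [gl Hgl lgl] := ex 1 g erefl g0 gN; have [hl Hhl lhl] := ex 1 h erefl h0 hN.
have [gr Hgr lgr] := ex (-1) g erefl g0 gN.
have [hr Hhr lhr] := ex (-1) h erefl h0 hN.
have eq_l : (gl + hl)%N = a.
  apply: unique_minimizer_inj (unique_minimizerM pp DN Hgl Hhl) _.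
  split=> // i ghi ia; rewrite !weightN.
  have iN := lt_gh _ ghi; have aN := lt_gh _ gha.
  have := Wi _ ghi; have [ab_i|ab_i] := boolP (a <= i <= b)%N => /=.
    rewrite -(@ler_pM2l _ N%:Z) //; lia.
  rewrite -lezD1 -(@ler_pM2l _ N%:Z) //; lia.
have eq_r : (gr + hr)%N = b.
  apply: unique_minimizer_inj (unique_minimizerM pp DN Hgr Hhr) _.
  split=> // i ghi ib; rewrite !weightN Wb.
  have iN := lt_gh _ ghi; have bN := lt_gh _ ghb.
  have := Wi _ ghi; have [ab_i|ab_i] := boolP (a <= i <= b)%N => /=.
    rewrite -(@ler_pM2l _ N%:Z) //; lia.
  rewrite -lezD1 -(@ler_pM2l _ N%:Z) //; lia.
have edge (f : {poly int}) l r :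
    (size f <= N)%N -> (l < size f)%N -> (r < size f)%N ->
    unique_minimizer p (d * N%:Z) (e * N%:Z + 1) f l ->
    unique_minimizer p (d * N%:Z) (e * N%:Z + -1) f r ->
    (l <= r)%N /\ (d %| e * (r - l)%N)%Z.
  move=> fN lf rf [fl Hl] [fr Hr].
  have [<-|rl] := eqVneq l r; first by rewrite subnn mulr0 dvdz0.
  have := Hr _ fl rl; have := Hl _ fr; rewrite eq_sym rl => /(_ isT).
  rewrite !weightN => H1 H2.
  (* The two perturbed inequalities bound [N] times the gap, of either sign, by [r - l < N]; so the
     gap is zero. *)
  have Weq : weight p d e f l = weight p d e f r.
    apply/eqP; rewrite eq_le; apply/andP.
    by split; rewrite -ltzD1 -(@ltr_pM2l _ N%:Z) //; lia.
  have lr : (l <= r)%N by rewrite Weq in H1; lia.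
  split=> //; move: Weq; rewrite /weight => Weq.
  have -> : e * (r - l)%N = d * ((nu_fin p f`_l)%:Z - (nu_fin p f`_r)%:Z).
    by rewrite -subzn // !mulrBr; lia.
  exact: dvdz_mulr.
have [glr dg] := edge g gl gr gN lgl lgr Hgl Hgr.
have [hlr dh] := edge h hl hr hN lhl lhr Hhl Hhr.
exists (gr - gl)%N, (hr - hl)%N; split=> //; lia.
Qed.

(** * Slope inequalities in the extended rationals *)

Lemma nu_finE p m : m != 0 -> nu p m = ((nu_fin p m)%:R : rat)%:E.
Proof. by rewrite /nu => /negPf ->. Qed.

Lemma nu_eq0 p m : nu p m = 0%E -> m != 0 /\ nu_fin p m = 0%N.
Proof. by rewrite /nu; case: eqVneq => // _ [] /eqP; rewrite pnatr_eq0 => /eqP. Qed.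

Lemma nu_divE p m s : m != 0 -> (0 < s)%N ->
  (nu p m / (s%:R : rat)%:E)%E = ((nu_fin p m)%:R / s%:R : rat)%:E.
Proof.
by move=> m0 s0; rewrite nu_finE // inver pnatr_eq0 gtn_eqF.
Qed.

Lemma lt_nu_div p x y s t : x != 0 -> y != 0 -> (0 < s)%N -> (0 < t)%N ->
  (nu p x / (s%:R : rat)%:E < nu p y / (t%:R : rat)%:E)%E =
  (nu_fin p x * t < nu_fin p y * s)%N.
Proof.
move=> x0 y0 s0 t0; rewrite !nu_divE // lte_fin ltr_pdivrMr ?ltr0n //.
by rewrite mulrAC ltr_pdivlMr ?ltr0n // -!natrM ltr_nat.
Qed.

Lemma le_nu_div p x y s t : x != 0 -> y != 0 -> (0 < s)%N -> (0 < t)%N ->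
  (nu p x / (s%:R : rat)%:E <= nu p y / (t%:R : rat)%:E)%E =
  (nu_fin p x * t <= nu_fin p y * s)%N.
Proof.
move=> x0 y0 s0 t0; rewrite !nu_divE // lee_fin ler_pdivrMr ?ltr0n //.
by rewrite mulrAC ler_pdivlMr ?ltr0n // -!natrM ler_nat.
Qed.

Theorem theorem1p6 (n : nat) (f : {poly int})
  (size_f : size f = n.+1)
  (a0an_neq0 : f`_0 * f`_n != 0)
  (p q : nat) (p_prime : prime p) (q_prime : prime q) (p_neq_q : p != q)
  (i_nu_a1 : nu p f`_1 = 0%E)
  (i_nu_an : (0 < nu p f`_n)%E)
  (i_slope : forall i : nat, (1 < i < n)%N ->
     (nu p f`_i / (i%:R - 1)%:E > nu p f`_n / (n%:R - 1)%:E)%E)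
  (ii_nu_a0 : nu q f`_0 = 0%E)
  (ii_slope : forall i : nat, (1 <= i <= n)%N ->
     (nu q f`_i / i%:R%:E >= nu q f`_n / n%:R%:E)%E)
  (ii_ndvd : ~~ (n %| nu_fin q f`_n)%N)
  (iii_gcd : gcdn (nu_fin p f`_n) (n - 1) = 1%N) :
  irreducible_poly (map_poly (intr : int -> rat) f).
Proof.
have [a0 an] : f`_0 != 0 /\ f`_n != 0.
  by move: a0an_neq0; rewrite mulf_eq0 negb_or => /andP.
have [a1 vpa1] := nu_eq0 i_nu_a1; have [_ vqa0] := nu_eq0 ii_nu_a0.
move: i_nu_an; rewrite nu_finE // lte_fin ltr0n => k0.
(* For [n = 0] the valuation [nu_q(a_n)] is 0, which 0 divides; for [n = 1] it is [nu_p(a_n)] that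
   vanishes. *)
have n2 : (1 < n)%N.
  case: (n) k0 ii_ndvd => [|[|n']] //; first by rewrite vqa0.
  by rewrite vpa1.
have lt_f i : f`_i != 0 -> (i <= n)%N.
  move=> fi; rewrite -ltnS -size_f ltnNge.
  by apply: contra fi => /(nth_default 0) ->.
have size_factors (g h : {poly int}) : f = g * h ->
    [/\ (0 < size g)%N, (0 < size h)%N & (size g + size h = n.+2)%N].
  move=> fgh; have [g0 h0] : g != 0 /\ h != 0.
    apply/andP; rewrite -negb_or -mulf_eq0 -fgh.
    by apply: contraNneq a0 => ->; rewrite coef0.
  rewrite !size_poly_gt0; split=> //.
  have := size_mul g0 h0; rewrite -fgh size_f => ->.
  by rewrite prednK // addn_gt0 size_poly_gt0 g0.
have p_split (g h : {poly int}) : f = g * h -> ((n <= size g) || (n <= size h))%N.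
  (* Indices 1 and [n] tie at weight [- nu_p(a_n) < 0], while index 0 has weight at least 0. *)
  move=> fgh; have := @newton_edge_mul p (n - 1)%N (- (nu_fin p f`_n)%:Z) 1 n g h.
  rewrite -fgh => /(_ p_prime).
  case; rewrite ?ltz_nat ?subn_gt0 //; first exact: ltnW.
  - by rewrite /weight vpa1; lia.
  - move=> i fi; rewrite /weight vpa1; have := lt_f _ fi.
    have [->|i1] := eqVneq i 1%N.
      by rewrite leqnn ltnW //= vpa1.
    have [->|i0] := posnP i.
      move=> _ /=; rewrite !mulr0 mulr1 add0r addr0.
      by rewrite (lt_le_trans (y := 0)) ?oppr_lt0 ?ltz_nat ?mulr_ge0.
    have [->|ni le_in] := eqVneq i n; first by rewrite leqnn /=; lia.
    have i_int : (1 < i < n)%N by lia.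
    have i1E (j : nat) : (0 < j)%N -> (j%:R - 1 : rat) = (j - 1)%:R.
      by move=> j0; rewrite natrB.
    have := i_slope i i_int; rewrite !i1E ?lt_nu_div //; [|lia..].
    by rewrite le_in /=; nia.
  (* By coprimality [n - 1] divides [x]. Since [x + y = n - 1], one of [x], [y] equals [n - 1] and
     bounds the degree of its factor from below. *)
  move=> x [y [xy xg yh dx dy]].
  have dvd_n1 z : ((n - 1)%N%:Z %| - (nu_fin p f`_n)%:Z * z%:Z)%Z -> (n - 1 %| z)%N.
    rewrite mulNr dvdzE abszN abszM /= Gauss_dvdr //.
    by rewrite coprime_sym /coprime iii_gcd.
  have [x0|x0] := posnP x.
    by apply/orP; right; lia.
  by have := dvdn_leq x0 (dvd_n1 _ dx); lia.
have q_split (g h : {poly int}) : f = g * h -> size g != 2%N.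
  move=> fgh; apply/eqP => sg.
  have := @newton_edge_mul q n (- (nu_fin q f`_n)%:Z) 0 n g h.
  rewrite -fgh => /(_ q_prime).
  case; rewrite ?ltz_nat ?(ltnW n2) //.
  - by rewrite /weight vqa0; lia.
  - move=> i fi; rewrite /weight vqa0; have := lt_f _ fi => le_in.
    rewrite le_in /=; have [->|i0] := posnP i; first by rewrite vqa0.
    have := ii_slope i; rewrite i0 le_in => /(_ isT).
    rewrite le_nu_div ?(ltnW n2) // !mulr0 addr0 mulNr subr_ge0 -!PoszM lez_nat.
    by rewrite [X in _ -> (_ <= X)%N]mulnC.
  (* Here [x + y = n] with [x <= 1] and [y <= n - 1], so [x = 1] and [n] would divide
     [nu_q(a_n)]. *)
  move=> x [y [xy xg yh dx dy]].
  have [_ _] := size_factors _ _ fgh; rewrite sg => -[sh].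
  have x1 : x = 1%N by move: xg yh; rewrite sg (sh : size h = n); lia.
  move: dx; rewrite x1 mulr1 dvdzE abszN /=; exact/negP.
split; first by rewrite size_rat_int_poly size_f; lia.
(* Gauss's lemma: a rational divisor is a scalar multiple of an integer one. *)
move=> u su /[dup] uf /dvdpP_rat_int[g [c c0 ug] [h fgh]].
have szu : size u = size g by rewrite ug size_scale // size_rat_int_poly.
rewrite -(dvdp_size_eqp uf) size_rat_int_poly szu size_f.
(* Sizes are degrees plus one: a factor of size [n] would leave size 2 for the other, so one factor
   has size [n.+1] and the other is constant. *)
have arith (k l : nat) : [/\ (0 < k)%N, (0 < l)%N & (k + l = n.+2)%N] ->
    k != 1%N -> k != 2%N -> l != 2%N -> ((n <= k) || (n <= l))%N -> n.+1 == k.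
  by case; lia.
rewrite eq_sym; apply: arith (size_factors _ _ fgh) _ (q_split _ _ fgh) _ _.
- by rewrite -szu.
- exact: q_split (etrans fgh (mulrC _ _)).
- exact: p_split fgh.
Qed.
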